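(* Let $m$ and $n$ be positive even integers. The number of group homomorphisms from $D_m$ into $D_n$ is $$4+4n+n\left(\sum_{k\mid \gcd(m,n)}\phi(k)\right),$$ where the sum runs over the positive divisors $k$ of $\gcd(m,n)$.
   Context: For a positive integer $l$, $D_l$ denotes the finite (dihedral) group, of order $2l$, generated by two generators $r_l$ and $f_l$ subject to the relations $r_l^l = e = f_l^2$ and $r_l f_l = f_l r_l^{-1}$ (in particular $D_2$ is the Klein four-group). $\phi$ denotes Euler's totient function. Homomorphisms are not required to be injective. *)

(* Defs.v *)
From mathcomp Require Import all_boot all_fingroup all_solvable.

Set Implicit Arguments.
Unset Strict Implicit.
Unset Printing Implicit Defensive.

(* 'D_m is indexed by the order of the group, so that the dihedral group with *)
(* presentation < r, f | r ^ l, f ^ 2, r f = f r ^ -1 > is 'D_(l.*2), for     *)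
(* l > 1 (see card_dihedral and Grp_dihedral); 'D_4 is the Klein four-group.  *)

(* All group homomorphisms from aT to rT, injective or not. Finite functions  *)
(* are used rather than {morphism _ >-> _} so as to count homomorphisms up to *)
(* extensional equality.                                                      *)
Definition group_homs (aT rT : finGroupType) : {set {ffun aT -> rT}} :=
  [set f : {ffun aT -> rT} | morphic [set: aT] f].

(* Main.v *)
(* In <x, y | x^m, y^2, x^y = x^-1> every pair (u, v) satisfying the same       *)
(* relations is the image of (x, y) under exactly one homomorphism, so one      *)
(* counts such pairs in D_n, where <r> is the cyclic subgroup of index 2. If u  *)
(* is in <r>, then u^m = 1 leaves gcd(m, n) choices; any of the n elements v    *)
(* outside <r> fits, while v in <r> requires u^2 = v^2 = 1, which gives 2 * 2   *)
(* pairs. If u is one of the n elements outside <r>, then v is an involution or *)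
(* 1 commuting with u: the four choices are z and u z with z in <r>, z^2 = 1.   *)
Require Import Defs.
From mathcomp Require Import all_boot all_fingroup all_solvable.
From mathcomp Require Import zify.

Set Implicit Arguments.
Unset Strict Implicit.
Unset Printing Implicit Defensive.

Local Open Scope group_scope.

(** As [D_m] is the semidirect product of [<[x]>] and [<[y]>] ([dihedral_generators]),
    [card_dihedral_homs] reduces the problem to counting pairs, which [card_dihedral_pairs] does by
    fibres over [u]. Evenness of [n] gives [<[r]>] exactly two square roots of 1; evenness of [m]
    makes [u ^+ m = 1] automatic once [u ^+ 2 = 1]. The gcd that appears becomes the totient sum by
    Gauss's identity. *)

Lemma conj_cycle_inv (gT : finGroupType) (x y z : gT) :
  x ^ y = x^-1 -> z \in <[x]> -> z ^ y = z^-1.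
Proof. by move=> xy /cycleP[i ->]; rewrite conjXg xy expgVn. Qed.

(** The solutions form the unique subgroup of order [d = gcdn m #|G|], generated by [x ^+ (#[x] %/
    d)]. *)
Lemma card_cyclic_expg_eq1 (gT : finGroupType) (G : {group gT}) m :
  cyclic G -> #|[set z in G | z ^+ m == 1]| = gcdn m #|G|.
Proof.
move=> cycG; have /cyclicP[x defG] := cycG; set d := gcdn m #|G|.
have d_dvd : d %| #[x] by rewrite orderE -defG dvdn_gcdr.
have d_gt0 : 0 < d by rewrite gcdn_gt0 cardG_gt0 orbT.
have oH : #|<[x ^+ (#[x] %/ d)]>| = d.
  rewrite -orderE orderXdiv ?dvdn_div //.
  by rewrite -{1}(divnK d_dvd) mulKn // divn_gt0 // dvdn_leq.
rewrite -[RHS]oH; apply: eq_card => z; rewrite inE.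
have sHG : <[x ^+ (#[x] %/ d)]> \subset G by rewrite defG cycleX.
apply/andP/idP => [[Gz zm]|Hz]; last first.
  split; first exact: subsetP Hz.
  rewrite -order_dvdn (dvdn_trans (order_dvdG Hz)) // oH; exact: dvdn_gcdl.
(* Among subgroups of a cyclic group, inclusion amounts to divisibility of orders. *)
rewrite -cycle_subG -(cardSg_cyclic cycG) ?cycle_subG //.
  by rewrite oH dvdn_gcd -orderE order_dvdn zm order_dvdG.
by rewrite -cycle_subG.
Qed.

Section DihedralHoms.

Variables (aT rT : finGroupType) (x y : aT).
Hypotheses (defG : <[x]> ><| <[y]> = [set: aT]) (xy : x ^ y = x^-1).

(** The power maps on [<[x]>] and [<[y]>] glue over the semidirect product because they respect
    conjugation. *)
Lemma dihedral_hom_ext u v :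
    u ^+ #[x] = 1 -> v ^+ #[y] = 1 -> u ^ v = u^-1 ->
  exists f : {morphism [set: aT] >-> rT}, f x = u /\ f y = v.
Proof.
move=> /eqP; rewrite -order_dvdn => dvd_u /eqP; rewrite -order_dvdn => dvd_v uv.
have act : {in <[x]> & <[y]>, morph_act 'J 'J (eltm dvd_u) (eltm dvd_v)}.
  move=> a _ Xa /cycleP[j ->]; rewrite /= eltmE.
  (* Each further factor [y] inverts [a], and [v] inverts its image; [a] stays general since the
     induction hypothesis is used at [a^-1]. *)
  elim: j a Xa => [|j IHj] a Xa; first by rewrite !expg0 !conjg1.
  have Ua : eltm dvd_u a \in <[u]>.
    by case/cycleP: Xa => i ->; rewrite eltmE mem_cycle.
  rewrite !expgS !conjgM (conj_cycle_inv xy Xa) IHj ?groupV //.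
  by rewrite (conj_cycle_inv uv Ua) morphV.
exists (sdprodm_morphism defG act); split.
  by rewrite /= sdprodmEl ?cycle_id //=; apply: eltm_id.
by rewrite /= sdprodmEr ?cycle_id //=; apply: eltm_id.
Qed.

(** Evaluation at the two generators is injective, and [dihedral_hom_ext] shows that its image is
    exactly this set of pairs. *)
Lemma card_dihedral_homs :
  #|group_homs aT rT| =
    #|[set uv : rT * rT | [&& uv.1 ^+ #[x] == 1, uv.2 ^+ #[y] == 1
                            & uv.1 ^ uv.2 == uv.1^-1]]|.
Proof.
pose ev (f : {ffun aT -> rT}) := (f x, f y).
have ev_inj : {in group_homs aT rT &, injective ev}.
  move=> f g; rewrite !inE => fM gM [fgx fgy]; apply/ffunP => a.
  have [_ defXY _ _] := sdprodP defG.
  have : a \in <[x]> * <[y]> by rewrite defXY inE.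
  case/mulsgP=> _ _ /cycleP[i ->] /cycleP[j ->] ->.
  have homE (h : {ffun aT -> rT}) : morphic [set: aT] h ->
      h (x ^+ i * y ^+ j) = h x ^+ i * h y ^+ j.
    by move=> hM; rewrite -(morphmE hM) morphM ?morphX ?inE.
  by rewrite !homE // fgx fgy.
rewrite -(card_in_imset ev_inj); apply: eq_card => -[u v].
rewrite inE /=; apply/imsetP/and3P => [[f] | [/eqP xu /eqP yv /eqP uv]].
  rewrite inE => fM [-> ->].
  rewrite -(morphmE fM) -!morphX -?morphJ -?morphV ?inE //.
  by rewrite !expg_order xy morph1 !eqxx.
have [f [fx fy]] := dihedral_hom_ext xu yv uv.
exists [ffun a => f a]; last by rewrite /ev !ffunE fx fy.
rewrite inE; apply/morphicP => a b _ _.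
by rewrite !ffunE morphM ?inE.
Qed.

End DihedralHoms.

Lemma dihedral_generators q : 1 < q ->
  exists x y : 'D_(q.*2),
    [/\ #[x] = q, #[y] = 2, x ^ y = x^-1
      & <[x]> ><| <[y]> = [set: 'D_(q.*2)]].
Proof.
move=> q_gt1; have := isoGrp_hom (Grp_dihedral q_gt1).
case/existsP=> -[x y] /= /eqP[defG xq y2 xy].
have nXY : <[y]> \subset 'N(<[x]>).
  by rewrite cycle_subG inE -cycleJ xy cycleV.
have defXY : <[x]> * <[y]> = [set: 'D_(q.*2)] by rewrite -norm_joinEr.
have := mul_cardG <[x]> <[y]>; rewrite defXY card_dihedral // -!orderE.
have x_le : #[x] <= q by rewrite dvdn_leq ?(ltnW q_gt1) // order_dvdn xq.
have y_le : #[y] <= 2 by rewrite dvdn_leq // order_dvdn y2.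
have TI_gt0 : 0 < #|<[x]> :&: <[y]>| by apply: cardG_gt0.
move=> card_eq.
(* The relations only bound the orders by [q] and 2; the group order [q.*2] forces equality and a
   trivial intersection. *)
have [ox [oy TI1]] : #[x] = q /\ #[y] = 2 /\ #|<[x]> :&: <[y]>| = 1%N.
  move: card_eq x_le y_le TI_gt0 q_gt1.
  move: #[x] #[y] #|_| => a b t abE a_le b_le t_gt0 q_gt1.
  have t1 : t = 1%N by have := leq_mul a_le b_le; nia.
  have b2 : b = 2 by nia.
  by split; [nia | split].
exists x, y; split=> //.
by rewrite sdprodE // (card1_trivg TI1).
Qed.

Section CountPairs.

Variables (gT : finGroupType) (n : nat) (x y : gT).
Hypotheses (n_even : ~~ odd n) (ox : #[x] = n) (oy : #[y] = 2).
Hypotheses (xy : x ^ y = x^-1) (defG : <[x]> ><| <[y]> = [set: gT]).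

Let notinX u : u \notin <[x]> -> exists2 a, a \in <[x]> & u = a * y.
Proof.
move=> X'u; have [_ defXY _ _] := sdprodP defG.
have : u \in <[x]> * <[y]> by rewrite defXY inE.
case/mulsgP=> a b Xa; rewrite (cycle2g oy) !inE => /pred2P[] -> defu.
  by rewrite defu mulg1 Xa in X'u.
by exists a.
Qed.

Let conjX u z : u \notin <[x]> -> z \in <[x]> -> z ^ u = z^-1.
Proof.
move=> /notinX[a Xa ->] Xz; rewrite conjgM.
have -> : z ^ a = z.
  by apply/conjg_fixP/commgP/(centsP (cycle_abelian x)).
exact: conj_cycle_inv xy Xz.
Qed.

Let expg2X' u : u \notin <[x]> -> u ^+ 2 = 1.
Proof.
move=> /notinX[a Xa ->].
have y2 : y * y = 1 by rewrite -(expgS y 1) -oy expg_order.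
have yV : y^-1 = y by apply/eqP; rewrite eq_invg_mul y2.
have := conj_cycle_inv xy Xa; rewrite conjgE yV => ya.
by rewrite expgS expg1 -mulgA ya mulgV.
Qed.

Let mulX' u v : u \notin <[x]> -> v \notin <[x]> -> u * v \in <[x]>.
Proof.
move=> /notinX[a Xa ->] /notinX[b Xb ->].
have y2 : y * y = 1 by rewrite -(expgS y 1) -oy expg_order.
rewrite -mulgA (conjgC b) (mulgA y) y2 mul1g (conj_cycle_inv xy Xb).
by rewrite groupM ?groupV.
Qed.

Let cardX' : #|~: <[x]>| = n.
Proof.
have [_ defXY _ tiXY] := sdprodP defG.
have oG : #|[set: gT]| = (n * 2)%N by rewrite -ox -oy -(TI_cardMg tiXY) defXY.
by rewrite cardsCs setCK -cardsT oG -orderE ox muln2 -addnn addnK.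
Qed.

Lemma card_sqrt1_cycle : #|[set z in <[x]> | z ^+ 2 == 1]| = 2.
Proof.
rewrite card_cyclic_expg_eq1 ?cycle_cyclic // -orderE ox.
by apply/gcdn_idPl; rewrite dvdn2.
Qed.

Lemma card_dihedral_pairs m : ~~ odd m ->
  #|[set uv : gT * gT | [&& uv.1 ^+ m == 1, uv.2 ^+ 2 == 1
                          & uv.1 ^ uv.2 == uv.1^-1]]| =
    (4 + 4 * n + n * gcdn m n)%N.
Proof.
move=> m_even; set Z := [set z in <[x]> | z ^+ 2 == 1].
set S := [set uv | _]; pose A := [set u in <[x]> | u ^+ m == 1].
have um (u : gT) : u ^+ 2 = 1 -> u ^+ m == 1.
  by move=> u2; rewrite -(even_halfK m_even) -mul2n expgM u2 expg1n.
pose F u := [set v | (u, v) \in S].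
have FE (u v : gT) : (v \in F u) = [&& u ^+ m == 1, v ^+ 2 == 1 & u ^ v == u^-1].
  by rewrite !inE.
(* The first term counts [v] outside [<[x]>], all of which invert [u]. The second counts [v] inside:
   these commute with [u], so [u = u^-1] is required. *)
have cardF u : u \in <[x]> -> #|F u| = (n * (u \in A) + 2 * (u \in Z))%N.
  move=> Xu; rewrite -(cardsID <[x]>) addnC; congr (_ + _)%N.
    rewrite -cardX' [u \in A]inE Xu /=; case: eqP => um1; last first.
      rewrite muln0; apply: eq_card0 => v.
      by rewrite in_setD FE (introF eqP um1) andbF.
    rewrite muln1; apply: eq_card => v; rewrite in_setD FE in_setC.
    have [//|X'v] := boolP (v \in <[x]>).
    by rewrite um1 (expg2X' X'v) (conjX X'v Xu) !eqxx.
  rewrite -card_sqrt1_cycle -/Z [u \in Z]inE Xu /=.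
  have uV : (u ^+ 2 == 1) = (u == u^-1).
    by rewrite [RHS]eq_sym eq_invg_mul -(expgS u 1).
  case: eqP => u2; [rewrite muln1 | rewrite muln0].
    apply: eq_card => v; rewrite in_setI FE [RHS]inE andbC.
    have [Xv|//] := boolP (v \in <[x]>); rewrite um //=.
    rewrite (conjg_fixP _) -?uV ?u2 ?eqxx ?andbT //.
    exact/commgP/(centsP (cycle_abelian x)).
  apply: eq_card0 => v; rewrite in_setI FE.
  have [Xv|] := boolP (v \in <[x]>); last by rewrite andbF.
  rewrite (conjg_fixP _) -?uV; last exact/commgP/(centsP (cycle_abelian x)).
  by move/eqP/negPf: u2 => ->; rewrite !andbF.
have cardF' u : u \notin <[x]> -> #|F u| = 4.
  move=> X'u; have uV : u^-1 = u.
    by apply/eqP; rewrite eq_invg_mul -(expgS u 1) expg2X'.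
  (* Commuting is symmetric, and [u] inverts [v]. *)
  have conjE v : v \in <[x]> -> (u ^ v == u) = (v ^+ 2 == 1).
    move=> Xv; rewrite conjg_fix -invg_comm invg_eq1 -conjg_fix conjX //.
    by rewrite eq_invg_mul -(expgS v 1).
  have um1 : u ^+ m == 1 by rewrite um ?expg2X'.
  rewrite -(cardsID <[x]>) -[4]/(2 + 2)%N; congr (_ + _)%N.
    rewrite -card_sqrt1_cycle; apply: eq_card => v; rewrite in_setI FE [RHS]inE uV um1 andbC.
    by have [Xv|//] := boolP (v \in <[x]>); rewrite conjE // andbb.
  (* The solutions outside [<[x]>] form the coset [u Z]: [u * v] lies in [<[x]>] and conjugates [u]
     as [v] does. *)
  rewrite -card_sqrt1_cycle -[RHS](card_lcoset _ u); apply: eq_card => v.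
  rewrite mem_lcoset in_setD FE [RHS]inE uV um1 /=.
  have [Xv|X'v] := boolP (v \in <[x]>).
    by rewrite groupMr ?(negPf X'u).
  rewrite (mulX' X'u X'v) (expg2X' X'v) eqxx -conjE ?mulX' //=.
  by rewrite conjgM (conjgE u u) mulKg.
have -> : #|S| = (\sum_u #|F u|)%N.
  rewrite -sum1_card (eq_bigr (fun u => \sum_(v | (u, v) \in S) 1)%N).
    rewrite pair_big_dep /=; apply: eq_bigl => -[u v] //.
  by move=> u _; rewrite -sum1_card; apply: eq_bigl => v; rewrite inE.
rewrite (bigID (mem <[x]>)) /= (eq_bigr _ cardF) [X in (_ + X)%N](eq_bigr _ cardF').
rewrite big_split /= -!big_distrr /= sum_nat_const.
have cardZA (B : {set gT}) : B \subset <[x]> -> (\sum_(u in <[x]>) (u \in B) = #|B|)%N.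
  move=> sBX; rewrite -sum1_card big_mkcond [RHS]big_mkcond /=.
  apply: eq_bigr => u _; have [/(subsetP sBX)-> //|_] := boolP (u \in B).
  by case: ifP.
rewrite !cardZA ?card_sqrt1_cycle ?card_cyclic_expg_eq1 ?cycle_cyclic //; last 2 first.
- by apply/subsetP => u; rewrite inE => /andP[].
- by apply/subsetP => u; rewrite inE => /andP[].
have -> : #|(fun u => u \notin <[x]>)| = n.
  by rewrite -[RHS]cardX'; apply: eq_card => u; rewrite in_setC.
by rewrite -[#|<[x]>%G|]/#[x] ox; lia.
Qed.

End CountPairs.

Local Close Scope group_scope.

Theorem theorem3 (m n : nat) (m_gt0 : 0 < m) (n_gt0 : 0 < n)
    (m_even : ~~ odd m) (n_even : ~~ odd n) :
  #|group_homs 'D_(m.*2) 'D_(n.*2)| =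
    4 + 4 * n + n * (\sum_(k <- divisors (gcdn m n)) totient k).
Proof.
have even_gt1 k : 0 < k -> ~~ odd k -> 1 < k by case: k => [|[]].
have [x [y [ox oy xy defG]]] := dihedral_generators (even_gt1 m m_gt0 m_even).
have [r [s [or os rs defH]]] := dihedral_generators (even_gt1 n n_gt0 n_even).
rewrite (card_dihedral_homs _ defG xy) ox oy.
rewrite (card_dihedral_pairs n_even or os rs defH m_even); congr (_ + n * _)%N.
have d_gt0 : 0 < gcdn m n by rewrite gcdn_gt0 m_gt0.
(* Gauss's identity sums over a filtered range, which is a permutation of the list [divisors]. *)
rewrite -[LHS]sum_totient_dvd -(big_mkord (dvdn^~ _)) -[LHS]big_filter.
apply: perm_big; apply: uniq_perm; rewrite ?filter_uniq ?iota_uniq ?divisors_uniq //.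
move=> k; rewrite mem_filter mem_index_iota -dvdn_divisors // ltnS /=.
by apply: andb_idr; apply: dvdn_leq.
Qed.
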